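(* Let $g:[0,\infty)\to[0,\infty)$ be a function with tame superpolynomial growth (TSPG). Let $\Gamma$ be an infinite amenable group generated by a finite symmetric set $S=S^{-1}\subset\Gamma$ whose growth function satisfies $\gamma_S(r-1)\ge g(r)$ for every integer $r\ge 1$. Then for every $0<\varepsilon<1$ there exists $N=N(\varepsilon)\in\mathbb{N}$ such that for every integer $n\ge N$, $$\text{Føl}(n)\ \ge\ g((1-\varepsilon)n).$$ In other words, $$\liminf_{n\to\infty}\ \frac{g^{-1}(\text{Føl}(n))}{n}\ \ge\ 1 .$$
   Context: A function $g:[0,\infty)\to[0,\infty)$ has tame superpolynomial growth (TSPG) if it is everywhere differentiable with $g'>0$ and $$\lim_{r\to\infty}\frac{r\,g'(r)\,g(\lambda r)}{g(r)^2}=\begin{cases}0 & \text{for every } 0<\lambda<1,\\ \infty & \text{for } \lambda=1.\end{cases}$$ Such a $g$ is strictly increasing and unbounded, so $g^{-1}(t)$ is defined for all $t\ge g(0)$. For an integer $r\ge 0$, $B_S(r)\subset\Gamma$ is the set of elements that can be written as a product of at most $r$ elements of $S$ (so $B_S(0)=\{e\}$), and $\gamma_S(r)=|B_S(r)|$. The (inner) boundary of $D\subset\Gamma$ is $\partial_S D=\{x\in D : \exists s\in S,\ sx\notin D\}$. The Følner function of $(\Gamma,S)$ is, for integers $n\ge 1$, $$\text{Føl}(n)=\min\{k\ge 1 : \exists D\subset\Gamma \text{ with } |D|=k \text{ and } k\ge n|\partial_S D|\};$$ a finitely generated group $\Gamma$ is amenable if and only if $\text{Føl}(n)<\infty$ for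 all $n\geq 1$ (Følner's criterion). *)

(* Defs.v *)
From HB Require Import structures.
From mathcomp Require Import all_boot all_order all_algebra.
From mathcomp Require Import finmap.
From mathcomp Require Import all_classical all_reals all_analysis.

Set Implicit Arguments.
Unset Strict Implicit.
Unset Printing Implicit Defensive.

Import Order.TTheory GRing.Theory Num.Theory.
Import numFieldNormedType.Exports.

Local Open Scope classical_set_scope.
Local Open Scope ring_scope.

Section TameGrowth.
Variable R : realType.
Implicit Types (g : R -> R) (lambda r : R).

(* A function on [0, +oo) is represented by a function on R of which only the
   values on `[0, +oo[ are used; the derivative at 0 is thus the right one. *)
Definition right_difference_quotient g (h : R) : R := (g h - g 0) / h.

Definition differentiable_with_pos_derivative g : Prop :=
  [/\ forall r, 0 < r -> derivable g r 1,
      forall r, 0 < r -> 0 < g^`()%classic r,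
      cvg (right_difference_quotient g @ 0^'+) &
      0 < lim (right_difference_quotient g @ 0^'+)].

Definition growth_ratio g lambda r : R :=
  r * g^`()%classic r * g (lambda * r) / g r ^+ 2.

Definition TSPG g : Prop :=
  [/\ forall r, 0 <= r -> 0 <= g r,
      differentiable_with_pos_derivative g,
      forall lambda, 0 < lambda < 1 ->
        growth_ratio g lambda r @[r --> +oo] --> 0 &
      growth_ratio g 1 r @[r --> +oo] --> +oo].

(* The inverse of g : [0, +oo) -> [0, +oo), with value +oo at +oo; it is
   unspecified at the reals that are not values of g. *)
Definition growth_inverse g : \bar R -> \bar R :=
  er_map ('pinv_(fun=> 0) `[0, +oo[ g).

End TameGrowth.

Section Groups.
Variable G : groupType.
Implicit Types (S D : {fset G}).

Definition symmetric_fset S : Prop := forall s, s \in S -> (s^-1)%g \in S.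

Definition generates S : Prop :=
  smallest (fun H : set G => group_closed (mem H)) [set` S] = [set: G].

(* A left-invariant, finitely additive probability measure on all subsets. *)
Definition invariant_mean (R : realType) (m : set G -> R) : Prop :=
  [/\ forall A, 0 <= m A,
      m [set: G] = 1,
      forall A B, A `&` B = set0 -> m (A `|` B) = m A + m B &
      forall (x : G) A, m [set (x * a)%g | a in A] = m A].

Definition amenable (R : realType) : Prop :=
  exists m : set G -> R, invariant_mean m.

Definition word_ball S (r : nat) : set G :=
  [set x | exists w : seq G,
     [/\ (size w <= r)%N, {subset w <= S} & x = (\prod_(s <- w) s)%g]].

Definition growth S (r : nat) : nat := #|` fset_set (word_ball S r)|.

Definition inner_boundary S D : {fset G} :=
  [fset x in D | has (fun s => (s * x)%g \notin D) S]%fset.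

Definition Folner_size S (n k : nat) : Prop :=
  (1 <= k)%N /\
  exists D, #|` D| = k /\ (n * #|` inner_boundary S D| <= k)%N.

(* As a set of naturals has a least element unless it is empty, the infimum
   is the minimum, with the usual convention that it is +oo when no D
   qualifies. *)
Definition Folner (R : realType) S (n : nat) : \bar R :=
  ereal_inf [set k%:R%:E | k in Folner_size S n].

End Groups.

(* Main.v *)
(* If n |bd D| <= |D|, averaging over x in the ball B(r) the number of d in D
   with x d outside D, which is at most r |bd D|, gives
   (n - r) gamma(r) <= n |D| for every r.  Taking r = floor ((1 - eps/2) n), so
   that gamma(r) >= g (r + 1) >= g ((1 - eps/2) n), one gets
   |D| >= (eps/2) g ((1 - eps/2) n), and tame superpolynomial growth makes the
   constant eps/2 negligible against replacing 1 - eps/2 by 1 - eps. *)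
Require Import Defs.
From HB Require Import structures.
From mathcomp Require Import all_boot all_order all_algebra.
From mathcomp Require Import finmap.
From mathcomp Require Import all_classical all_reals all_analysis.
From mathcomp Require Import ring lra.

Set Implicit Arguments.
Unset Strict Implicit.
Unset Printing Implicit Defensive.

Import Order.TTheory GRing.Theory Num.Theory.
Import numFieldNormedType.Exports.

Local Open Scope classical_set_scope.
Local Open Scope ring_scope.

(** * Counting exits from a finite subset of the group *)

Lemma count_inj_le (T U : eqType) (f : T -> U) (s : seq T) (t : seq U) :
  injective f -> uniq s -> (count (fun x => f x \in t) s <= size t)%N.
Proof.
move=> finj us; rewrite -size_filter -(size_map f); apply: uniq_leq_size.
  by rewrite map_inj_uniq ?filter_uniq.
by move=> y /mapP[x]; rewrite mem_filter => /andP[? _] ->.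
Qed.

Section Isoperimetry.
Variables (G : groupType) (S D : {fset G}).

(** Apply the letters of w from right to left. At the letter s, with x the product of the letters
    already applied, a newly leaving d has x d in [inner_boundary S D]; as d is determined by x d,
    each letter adds at most |bd D| exits. *)
Lemma count_exit_le (w : seq G) : {subset w <= S} ->
  (count (fun d => (\prod_(s <- w) s * d)%g \notin D) D
    <= size w * #|` inner_boundary S D|)%N.
Proof.
elim: w => [|s w IHw] wS.
  rewrite big_nil (@eq_in_count _ _ pred0) ?count_pred0// => d dD.
  by rewrite mul1g dD.
set x := (\prod_(s <- w) s)%g.
have exit_step d : d \in (D : seq G) ->
    (\prod_(s <- s :: w) s * d)%g \notin D ->
    ((x * d)%g \notin D) || ((x * d)%g \in inner_boundary S D).
  move=> dD; rewrite big_cons -/x -mulgA => sxdD.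
  case: (boolP ((x * d)%g \in D)) => //= xdD.
  rewrite !inE/= xdD; apply/hasP; exists s => //.
  by apply: wS; rewrite mem_head.
apply: (@leq_trans (count (fun d => ((x * d)%g \notin D) ||
    ((x * d)%g \in inner_boundary S D)) D)).
  rewrite -!size_filter; apply: uniq_leq_size; first by rewrite filter_uniq ?fset_uniq.
  by move=> d; rewrite !mem_filter => /andP[+ dD]; rewrite dD andbT; exact: exit_step.
apply: leq_trans (leq_addr (count (predI (fun d => (x * d)%g \notin D)
  (fun d => (x * d)%g \in inner_boundary S D)) D) _) _.
rewrite count_predUI mulSn addnC; apply: leq_add.
  by apply: count_inj_le; [exact: mulgI|exact: fset_uniq].
by apply: IHw => t tw; apply: wS; rewrite inE tw orbT.
Qed.

(** [fset_set] of an infinite set is empty by default, so the inclusion holds in both cases. *)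
Lemma mem_fset_set_word_ball r x : x \in fset_set (word_ball S r) -> word_ball S r x.
Proof.
have [fB|nfB] := pselect (finite_set (word_ball S r)).
  by rewrite in_fset_set// inE.
by rewrite /fset_set; case: pselect.
Qed.

(* Double counting of the pairs (x, d) in the product of the ball and D: those
   with xd in D are at most |D|^2, and each x sends at most r |bd D| points
   out of D. *)
Lemma growth_card_le r :
  (growth S r * #|` D| <=
     #|` D| * #|` D| + growth S r * (r * #|` inner_boundary S D|))%N.
Proof.
rewrite /growth; set B := fset_set _.
have cardE : (#|` B| * #|` D| =
    \sum_(x <- B) (count (fun d => (x * d)%g \in D) D +
                   count (fun d => (x * d)%g \notin D) D))%N.
  rewrite (eq_bigr (fun=> #|` D|)) => [|x _]; last exact: count_predC.
  by rewrite big_const_seq count_predT iter_addn_0 mulnC.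
rewrite cardE big_split leq_add//=.
  under eq_bigr do rewrite -sum1_count big_mkcond/=.
  rewrite exchange_big/=; under eq_bigr do rewrite -big_mkcond sum1_count.
  apply: (@leq_trans (\sum_(d <- D) #|` D|)%N).
    by apply: leq_sum => d _; apply: count_inj_le; [exact: mulIg|exact: fset_uniq].
  by rewrite big_const_seq count_predT iter_addn_0.
apply: (@leq_trans (\sum_(x <- B) (r * #|` inner_boundary S D|))%N).
  rewrite big_seq [leqRHS]big_seq; apply: leq_sum => x.
  move=> /mem_fset_set_word_ball[w [wr wS ->]].
  by rewrite (leq_trans (count_exit_le wS))// leq_mul2r wr orbT.
by rewrite big_const_seq count_predT iter_addn_0 mulnC.
Qed.

End Isoperimetry.

(** Multiply [growth_card_le] by n, replace n |bd D| by k = |D|, and cancel one factor k. For r >= n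
    the truncated subtraction makes the left side 0. *)
Lemma Folner_size_ge (G : groupType) (S : {fset G}) (n k r : nat) :
  Folner_size S n k -> ((n - r) * growth S r <= n * k)%N.
Proof.
move=> [k_gt0 [D [cardD bdD]]].
have := growth_card_le S D r; rewrite cardD; set b := #|` inner_boundary S D| in bdD *.
set y := growth S r => H.
rewrite mulnBl leq_subLR -(leq_pmul2r k_gt0) mulnDl -!mulnA addnC.
apply: (@leq_trans (n * (k * k + y * (r * b)))); first by rewrite leq_mul2l H orbT.
rewrite mulnDr leq_add2l (_ : n * (y * (r * b)) = r * (y * (n * b)))%N.
  by rewrite !leq_mul2l bdD !orbT.
by rewrite (mulnCA y) (mulnCA n) (mulnCA n).
Qed.

(** * Monotonicity, growth and inversion of TSPG functions *)

Section TameGrowthTheory.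
Variables (R : realType) (g : R -> R).
Hypothesis gT : TSPG g.

(** Near 0 on the right, g h is g 0 plus h times a difference quotient that converges. *)
Lemma TSPG_cvg0 : g x @[x --> 0^'+] --> g 0.
Proof.
case: gT => _ [_ _ cq _] _ _.
have h0 : h @[h --> 0^'+] --> (0 : R) by exact/cvg_at_right_filter/cvg_id.
have lim0 : (g 0 + right_difference_quotient g h * h) @[h --> 0^'+] --> g 0.
  by rewrite -[X in _ --> X]addr0 -[X in _ + X](mulr0
    (lim (right_difference_quotient g @ 0^'+))); apply: cvgD; [exact: cvg_cst|exact: cvgM].
apply: cvg_trans lim0; apply: near_eq_cvg; near=> h.
have hgt0 : 0 < h by near: h; exact: nbhs_right_gt.
by rewrite /= /right_difference_quotient divfK ?gt_eqF// addrC subrK.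
Unshelve. all: by end_near. Qed.

Lemma TSPG_continuous b : 0 < b -> {within `[0, b], continuous g}.
Proof.
have [_ [dg _ _ _] _ _] := gT.
have cg x : 0 < x -> {for x, continuous g}.
  by move=> x0; apply: differentiable_continuous; apply/derivable1_diffP/dg.
move=> b0; apply/continuous_within_itvP => //; split.
- by move=> x; rewrite in_itv/= => /andP[x0 _]; exact: cg.
- exact: TSPG_cvg0.
- by apply: cvg_at_left_filter; exact: cg.
Qed.

Lemma TSPG_lt x y : 0 <= x -> x < y -> g x < g y.
Proof.
have [_ [dg g'0 _ _] _ _] := gT.
move=> x0 xy; have y0 := le_lt_trans x0 xy.
apply: (@gtr0_derive1_lt_cc _ g 0 y) => //; last 2 first.
- by rewrite in_itv/= x0 ltW.
- by rewrite in_itv/= lexx ltW.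
- by move=> z; rewrite in_itv/= => /andP[z0 _]; exact: dg.
- by move=> z; rewrite in_itv/= => /andP[z0 _]; exact: g'0.
- exact: TSPG_continuous.
Qed.

Lemma TSPG_le x y : 0 <= x -> x <= y -> g x <= g y.
Proof.
by move=> x0; rewrite le_eqVlt => /predU1P[->//|xy]; exact/ltW/TSPG_lt.
Qed.

Lemma TSPG_gt0 x : 0 < x -> 0 < g x.
Proof.
have [g0 _ _ _] := gT.
by move=> x0; apply: le_lt_trans (TSPG_lt _ x0) => //; exact: g0.
Qed.

(* The ratio at lam is the ratio at 1, which is eventually at least 1, times
   g (lam r) / g r. *)
Lemma TSPG_small_ratio lam c : 0 < lam < 1 -> 0 < c ->
  \forall r \near +oo, g (lam * r) <= c * g r.
Proof.
have [_ _ g0 g1] := gT.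
move=> lam01 c0; have /cvgr0_norm_lt /(_ c c0) small := g0 _ lam01.
have /cvgryPge /(_ 1) big := g1.
near=> r.
have r0 : 0 < r by near: r; exact: nbhs_pinfty_gt.
have lr0 : 0 < lam * r by case/andP: lam01 => l0 _; rewrite mulr_gt0.
have gr0 := TSPG_gt0 r0.
have : `|growth_ratio g lam r| < c by near: r.
have : 1 <= growth_ratio g 1 r by near: r.
have -> : growth_ratio g lam r = growth_ratio g 1 r * (g (lam * r) / g r).
  rewrite /growth_ratio mul1r expr2; field.
  by rewrite gt_eqF.
move=> ge1 /(le_lt_trans (ler_norm _)) ltc.
rewrite -ler_pdivrMr//; apply/ltW/(le_lt_trans _ ltc).
by rewrite ler_peMl// divr_ge0// ltW// TSPG_gt0.
Unshelve. all: by end_near. Qed.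

(** [TSPG_small_ratio] with both constants 1/2 says that g at least doubles when a large argument
    doubles, so g (2^k r) grows at least like 2^k. *)
Lemma TSPG_unbounded (M : R) : exists2 b : R, 0 < b & M <= g b.
Proof.
have half01 : 0 < (2^-1 : R) < 1 by lra.
have /andP[half_gt0 _] := half01.
have [r0 [_ halve]] := TSPG_small_ratio half01 half_gt0.
pose r := `|r0| + 1.
have r_gt0 : 0 < r by rewrite ltr_wpDl.
have rr0 : r0 < r by rewrite (le_lt_trans (ler_norm _))// ltrDl.
have pow k : 2 ^+ k * g r <= g (2 ^+ k * r).
  elim: k => [|k IHk]; first by rewrite !mul1r.
  have kr : r0 < 2 ^+ k.+1 * r.
    apply: lt_le_trans rr0 _; apply: ler_peMl; first exact: ltW.
    by rewrite exprn_ege1// ler1n.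
  have := halve _ kr; rewrite exprS -!mulrA mulKf// => H.
  by rewrite -ler_pdivlMl// (le_trans IHk).
have g0 := TSPG_gt0 r_gt0.
exists (2 ^+ Num.bound (M / g r) * r); first by rewrite mulr_gt0// exprn_gt0.
apply: le_trans (pow _); rewrite -ler_pdivrMr//.
exact/ltW/upper_nthrootP.
Qed.

Lemma TSPG_surj t : g 0 <= t -> exists2 c, 0 <= c & g c = t.
Proof.
move=> g0t; have [b b0 tb] := TSPG_unbounded t.
have g0b := le_trans g0t tb.
have [|c] := @IVT _ g 0 b t (ltW b0) (TSPG_continuous b0).
  by rewrite min_l// max_r// g0t.
by rewrite in_itv/= => /andP[c0 _] <-; exists c.
Qed.

Lemma TSPG_growth_inverseK c : 0 <= c -> growth_inverse g (g c)%:E = c%:E.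
Proof.
move=> c0; rewrite /growth_inverse/= pinvKV//; last by rewrite inE/= in_itv/= c0.
move=> x y; rewrite !inE/= !in_itv/= !andbT => x0 y0 gxy.
have [|xy|//] := ltgtP x y.
  by move=> /(TSPG_lt x0); rewrite gxy ltxx.
by have := TSPG_lt y0 xy; rewrite gxy ltxx.
Qed.

(** A real t >= g x is at least g 0, hence a value of g, where [growth_inverse] is a genuine
    inverse; +oo is sent to +oo. *)
Lemma TSPG_growth_inverse_ge x t : 0 <= x -> ((g x)%:E <= t)%E ->
  (x%:E <= growth_inverse g t)%E.
Proof.
move=> x0; case: t => [t| |]; [|by rewrite /= !leey|by rewrite leeNy_eq].
rewrite lee_fin => gxt.
have [|c c0 gc] := TSPG_surj (t := t).
  exact: le_trans (TSPG_le (lexx 0) x0) gxt.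
rewrite -gc in gxt *; rewrite TSPG_growth_inverseK// lee_fin leNgt; apply/negP => cx.
by have := lt_le_trans (TSPG_lt c0 cx) gxt; rewrite ltxx.
Qed.

End TameGrowthTheory.

(** * Lower bounds for the Folner function and for the limit inferior *)

Lemma limn_einf_ge (R : realType) (u : (\bar R)^nat) (a : \bar R) N :
  (forall n, (N <= n)%N -> (a <= u n)%E) -> (a <= limn_einf u)%E.
Proof.
move=> au; rewrite limn_einf_lim.
apply: lime_ge; first exact: is_cvg_einfs.
exists N => // n /= Nn; apply/ereal_infP => _ [m /= nm <-].
by apply: au; apply: leq_trans nm.
Qed.

Section FolnerBound.
Variables (R : realType) (g : R -> R) (G : groupType) (S : {fset G}).
Hypothesis gT : TSPG g.
Hypothesis gS : forall r : nat, (1 <= r)%N -> g r%:R <= (growth S (r - 1))%:R.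

Lemma Folner_ge eps : 0 < eps < 1 ->
  exists N : nat, forall n : nat, (N <= n)%N ->
    ((g ((1 - eps) * n%:R))%:E <= Folner R S n)%E.
Proof.
move=> /andP[e0 e1].
set del := eps / 2.
have d0 : 0 < del by rewrite divr_gt0.
have d1 : 0 < 1 - del by rewrite /del; lra.
(* This ratio carries (1 - del) n to (1 - eps) n and is below 1 because del < eps; the constant del
   will absorb the factor n - r >= del n. *)
have [|r0 [_ small]] := TSPG_small_ratio gT (lam := (1 - eps) / (1 - del)) _ d0.
  by rewrite divr_gt0 ?subr_gt0//= ltr_pdivrMr// mul1r /del; lra.
exists (Num.bound `|r0 / (1 - del)|).+1 => n Nn.
have n0 : (0 < n)%N by exact: leq_trans Nn.
have nR0 : 0 < n%:R :> R by rewrite ltr0n.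
have r0n : r0 < (1 - del) * n%:R.
  rewrite mulrC -ltr_pdivrMr// (le_lt_trans (ler_norm _))//.
  by rewrite (lt_le_trans (archi_boundP _))// ler_nat ltnW.
apply: le_ereal_inf_tmp => _ [k kF <-]; rewrite lee_fin.
pose r := Num.truncn ((1 - del) * n%:R).
have /andP[rle rlt] : r%:R <= (1 - del) * n%:R < r.+1%:R by apply: truncn_itv; rewrite mulr_ge0// ltW.
have rn : (r < n)%N.
  by rewrite -(ltr_nat R) (le_lt_trans rle)// gtr_pMl// /del; lra.
have := Folner_size_ge r kF.
rewrite -(ler_nat R) !natrM natrB ?(ltnW rn)// => Hk.
(* The growth hypothesis is used at r + 1, which exceeds (1 - del) n although r is its
   truncation. *)
have gr : g ((1 - del) * n%:R) <= (growth S r)%:R.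
  have := gS (isT : 1 <= r.+1)%N; rewrite subn1; apply: le_trans.
  apply: TSPG_le => //; last exact: ltW.
  by rewrite mulr_ge0// ltW.
have /small : r0 < (1 - del) * n%:R by [].
rewrite mulrA divfK ?gt_eqF// => /le_trans; apply.
rewrite -(ler_pM2l nR0); apply: le_trans Hk.
rewrite mulrA; apply: ler_pM => //.
- by rewrite mulr_ge0// ltW.
- by apply/ltW/TSPG_gt0 => //; rewrite mulr_gt0.
- by rewrite lerBrDr; lra.
Qed.

End FolnerBound.

Theorem corollary3p12 (R : realType) (g : R -> R) (G : groupType)
    (S : {fset G}) :
  TSPG g ->
  infinite_set [set: G] ->
  amenable G R ->
  symmetric_fset S ->
  generates S ->
  (forall r : nat, (1 <= r)%N -> g r%:R <= (growth S (r - 1))%:R) ->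
  (forall eps : R, 0 < eps < 1 ->
     exists N : nat, forall n : nat, (N <= n)%N ->
       ((g ((1 - eps) * n%:R))%:E <= Folner R S n)%E) /\
  (1%:E <= limn_einf (fun n : nat =>
             growth_inverse g (Folner R S n) * (n%:R^-1)%:E))%E.
Proof.
move=> gT _ _ _ _ gS; split; first exact: Folner_ge.
apply/lee_subgt0Pr => e e0.
(* Since e may be 1 or more, it is capped to fall in the range of [Folner_ge]. *)
pose eps : R := Num.min e 2^-1.
have eps01 : 0 < eps < 1 by rewrite lt_min gt_min e0/=; lra.
have [N FN] := Folner_ge gT gS eps01.
apply: (@le_trans _ _ (1 - eps)%:E).
  by rewrite EFinB leeB// lee_fin ge_min lexx.
have /andP[eps0 eps1] := eps01.
(* Starting at N + 1 keeps n positive for the division. *)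
apply: (@limn_einf_ge _ _ _ N.+1) => n Nn.
have n0 : 0 < n%:R :> R by rewrite ltr0n (leq_trans _ Nn).
rewrite lee_pdivlMr// -EFinM; apply: TSPG_growth_inverse_ge => //; last exact/FN/ltnW.
by rewrite mulr_ge0// ltW ?subr_gt0.
Qed.
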